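(* Consider the system $\mathbf{x}_{t+1}=\mathbf{A}\mathbf{x}_t+\mathbf{G}\mathbf{d}_t+\mathbf{w}_t$, $\mathbf{z}_t=\mathbf{C}\mathbf{x}_t+\mathbf{v}_t$, $\mathbf{y}_t=\mathfrak{q}(\mathbf{z}_t)$ described in the context, and the observation PDF $$p(\mathbf{y}_t|\mathbf{x}_t)=\sum_{\kappa=1}^{K}\varphi_t^{\kappa}\,\mathcal{N}(\zeta_t^{\kappa}(\mathbf{y}_t);\mathbf{C}\mathbf{x}_t+\boldsymbol{\mu}_t^{\kappa},\mathbf{R}).$$ Assume that $\operatorname{rank}(\mathbf{C}\mathbf{G})=m$, and that the unknown input sequence is drawn from a set of i.i.d. Gaussian random variables with mean $\mathfrak{d}$ and covariance $\mathbf{D}$, independent of the noise sequence $\mathbf{w}_t$. Then the Gaussian sum filter for state-space systems with quantized outputs and unknown inputs is given as follows. For time $t=1$, the PDFs of the time update step are given by $p(\mathbf{x}_1)=\mathcal{N}(\mathbf{x}_1;\boldsymbol{\mu}_1,\mathbf{P}_1)$ and $p(\mathbf{d}_0)=\mathcal{N}(\mathbf{d}_0;\mathfrak{d},\mathbf{D})$. For $t=2,3,\dots$, the following steps are defined. **Measurement update.** The filtered PDFs of the current state $\mathbf{x}_t$ and of the previous sample of the unknown input $\mathbf{d}_{t-1}$, given the quantized output measurements $\mathbf{y}_1,\dots,\mathbf{y}_t$, are the Gaussian mixture models $$p(\mathbf{x}_t|\mathbf{y}_{1:t})=\sum_{k=1}^{M_{t|t}}\delta_{t|t}^{k}\,\mathcal{N}(\mathbf{x}_t;\hat{\mathbf{x}}_{t|t}^{k},\boldsymbol{\Sigma}_{t|t}^{k}),$$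 $$p(\mathbf{d}_{t-1}|\mathbf{y}_{1:t})=\sum_{k=1}^{M_{t|t}}\delta_{t|t}^{k}\,\mathcal{N}(\mathbf{d}_{t-1};\hat{\mathbf{d}}_{t-1|t}^{k},\boldsymbol{\Gamma}_{t-1|t}^{k}),$$ where $M_{t|t}=K M_{t|t-1}$, and for each pair $(\kappa,\ell)$, with $\kappa=1,\dots,K$ and $\ell=1,\dots,M_{t|t-1}$, a new index $k=(\ell-1)K+\kappa$ is defined such that $$\delta_{t|t}^{k}=\bar\delta_{t|t}^{k}\Big/\sum_{r=1}^{M_{t|t}}\bar\delta_{t|t}^{r},$$ $$\bar\delta_{t|t}^{k}=\varphi_t^{\kappa}\,\delta_{t|t-1}^{\ell}\,\mathcal{N}\big(\zeta_t^{\kappa}(\mathbf{y}_t);\mathbf{C}\hat{\mathbf{x}}_{t|t-1}^{\ell}+\boldsymbol{\mu}_t^{\kappa},\ \mathbf{R}+\mathbf{C}\boldsymbol{\Sigma}_{t|t-1}^{\ell}\mathbf{C}^\top\big),$$ $$\mathbf{K}_t^{\ell}=\boldsymbol{\Sigma}_{t|t-1}^{\ell}\mathbf{C}^\top(\mathbf{R}+\mathbf{C}\boldsymbol{\Sigma}_{t|t-1}^{\ell}\mathbf{C}^\top)^{-1},$$ $$\hat{\mathbf{x}}_{t|t}^{k}=\hat{\mathbf{x}}_{t|t-1}^{\ell}+\mathbf{K}_t^{\ell}\big(\zeta_t^{\kappa}(\mathbf{y}_t)-\mathbf{C}\hat{\mathbf{x}}_{t|t-1}^{\ell}-\boldsymbol{\mu}_t^{\kappa}\big),$$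 $$\boldsymbol{\Sigma}_{t|t}^{k}=(\mathbf{I}-\mathbf{K}_t^{\ell}\mathbf{C})\boldsymbol{\Sigma}_{t|t-1}^{\ell},$$ $$\mathbf{L}_t^{\ell}=\mathbf{D}\mathbf{G}^\top\mathbf{C}^\top(\mathbf{R}+\mathbf{C}\boldsymbol{\Sigma}_{t|t-1}^{\ell}\mathbf{C}^\top)^{-1},$$ $$\hat{\mathbf{d}}_{t-1|t}^{k}=\mathfrak{d}+\mathbf{L}_t^{\ell}\big(\zeta_t^{\kappa}(\mathbf{y}_t)-\mathbf{C}\hat{\mathbf{x}}_{t|t-1}^{\ell}-\boldsymbol{\mu}_t^{\kappa}\big),$$ $$\boldsymbol{\Gamma}_{t-1|t}^{k}=(\mathbf{I}-\mathbf{L}_t^{\ell}\mathbf{C}\mathbf{G})\mathbf{D},$$ where $K$, $\varphi_t^{\kappa}$, $\zeta_t^{\kappa}(\cdot)$ and $\boldsymbol{\mu}_t^{\kappa}$ are those of the observation PDF above. The initial values of the recursion are $M_{1|0}=1$, $\delta_{1|0}=1$, $\hat{\mathbf{x}}_{1|0}=\boldsymbol{\mu}_1$, and $\boldsymbol{\Sigma}_{1|0}=\mathbf{P}_1$. **Time update.** The predicted PDF of the state $\mathbf{x}_{t+1}$ given the measurements $\mathbf{y}_1,\dots,\mathbf{y}_t$ is $$p(\mathbf{x}_{t+1}|\mathbf{y}_{1:t})=\sum_{k=1}^{M_{t+1|t}}\delta_{t+1|t}^{k}\,\mathcal{N}(\mathbf{x}_{t+1};\hat{\mathbf{x}}_{t+1|t}^{k},\boldsymbol{\Sigma}_{t+1|t}^{k}),$$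 where $M_{t+1|t}=M_{t|t}$, $\delta_{t+1|t}^{k}=\delta_{t|t}^{k}$, and $$\hat{\mathbf{x}}_{t+1|t}^{k}=\mathbf{A}\hat{\mathbf{x}}_{t|t}^{k}+\mathbf{G}\mathfrak{d},\qquad \boldsymbol{\Sigma}_{t+1|t}^{k}=\mathbf{Q}+\mathbf{G}\mathbf{D}\mathbf{G}^\top+\mathbf{A}\boldsymbol{\Sigma}_{t|t}^{k}\mathbf{A}^\top.$$
   Context: Notation: $\mathcal{N}(\mathbf{x};\boldsymbol{\mu},\boldsymbol{\Sigma})$ denotes a Gaussian distribution of $\mathbf{x}$ with mean $\boldsymbol{\mu}$ and covariance matrix $\boldsymbol{\Sigma}$; $\mathbf{y}_{1:t}=\{\mathbf{y}_1,\dots,\mathbf{y}_t\}$; $\mathbf{I}$ is the identity matrix; PDF means probability density function. System: $\mathbf{x}_t\in\mathbb{R}^n$ is the state, $\mathbf{d}_t\in\mathbb{R}^m$ the unknown input, $\mathbf{z}_t\in\mathbb{R}^p$ the linear output (not physically measurable), $\mathbf{y}_t\in\mathbb{R}^p$ the measured output; $\mathbf{A}\in\mathbb{R}^{n\times n}$, $\mathbf{G}\in\mathbb{R}^{n\times m}$, $\mathbf{C}\in\mathbb{R}^{p\times n}$. The process noise $\mathbf{w}_t\in\mathbb{R}^n$ and linear output noise $\mathbf{v}_t\in\mathbb{R}^p$ are jointly independent Gaussian-distributed stochastic processes with zero mean and covariance matrices $\mathbf{Q}$ and $\mathbf{R}$, respectively. The initial condition $\mathbf{x}_1$ is Gaussian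 with mean $\boldsymbol{\mu}_1$ and covariance $\mathbf{P}_1$. The quantizer $\mathfrak{q}$ is piecewise constant: $\mathfrak{q}(\mathbf{z})=\boldsymbol{\eta}_i$ if $\mathbf{z}\in\mathcal{J}_i$, $i=1,\dots,L$ (possibly $L\to\infty$), where the sets $\mathcal{J}_i\subset\mathbb{R}^p$ are disjoint hyperrectangles that collectively partition $\mathbb{R}^p$. Observation model: the exact likelihood of $\mathbf{y}_t=\boldsymbol{\eta}_i$ is $\int_{\mathcal{J}_i}\mathcal{N}(\mathbf{z}_t;\mathbf{C}\mathbf{x}_t,\mathbf{R})\,d\mathbf{z}_t$. It is approximated by a Gauss–Legendre quadrature rule, which yields the $K$-term sum displayed in the claim; this sum is used as the observation PDF. The quantities $\varphi_t^{\kappa}$, $\zeta_t^{\kappa}(\cdot)$ and $\boldsymbol{\mu}_t^{\kappa}$ depend on the nonlinearity $\mathfrak{q}$, i.e., on the quantizer levels and sets. Filter: with the extended state $\tilde{\mathbf{x}}_t=[\mathbf{x}_t^\top,\mathbf{d}_{t-1}^\top]^\top$, the Gaussian sum filter is obtained by propagating the Bayesian filtering equations (Bayes measurement update followed by Chapman–Kolmogorov prediction) for $\tilde{\mathbf{x}}_t$ with the observation PDF above and the transition model $$p(\tilde{\mathbf{x}}_{t+1}|\tilde{\mathbf{x}}_t)=\mathcal{N}\left(\tilde{\mathbf{x}}_{t+1};\begin{bmatrix}\mathbf{A}\mathbf{x}_t+\mathbf{G}\mathfrak{d}\\ \mathfrak{d}\end{bmatrix},\begin{bmatrix}\mathbf{Q}+\mathbf{G}\mathbf{D}\mathbf{G}^\top&\mathbf{G}\mathbf{D}\\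 \mathbf{D}\mathbf{G}^\top&\mathbf{D}\end{bmatrix}\right).$$ The PDFs $p(\mathbf{x}_t|\mathbf{y}_{1:t})$, $p(\mathbf{d}_{t-1}|\mathbf{y}_{1:t})$ and $p(\mathbf{x}_{t+1}|\mathbf{y}_{1:t})$ are the corresponding marginals. *)

(* Defs.v *)
From HB Require Import structures.
From mathcomp Require Import all_boot all_order all_algebra.
From mathcomp Require Import finmap.
From mathcomp Require Import all_classical all_reals all_analysis.

Set Implicit Arguments.
Unset Strict Implicit.
Unset Printing Implicit Defensive.

Import Order.TTheory GRing.Theory Num.Theory.
Import numFieldNormedType.Exports.

Local Open Scope classical_set_scope.
Local Open Scope ring_scope.

(* MathComp-Analysis provides neither a measurable structure on R^n nor its
   Lebesgue measure.  R^n is 'cV[R]_n, with the Borel sigma-algebra, that is,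
   the one generated by the coordinates. *)

Definition cV_display : measure_display.
Proof. exact: default_measure_display. Qed.

Section measurable_cV.
Context (R : realType) (n : nat).

Definition cV_coord (i : 'I_n) (x : 'cV[R]_n) : R := x i 0.

Let cV_set0 : g_sigma_preimage cV_coord set0.
Proof. exact: sigma_algebra0. Qed.

Let cV_setC A : g_sigma_preimage cV_coord A -> g_sigma_preimage cV_coord (~` A).
Proof. exact: sigma_algebraC. Qed.

Let cV_bigcup (F : (set 'cV[R]_n)^nat) :
  (forall i, g_sigma_preimage cV_coord (F i)) ->
  g_sigma_preimage cV_coord (\bigcup_i (F i)).
Proof. exact: sigma_algebra_bigcup. Qed.

HB.instance Definition _ := @isMeasurable.Build cV_display 'cV[R]_n
  (g_sigma_preimage cV_coord) cV_set0 cV_setC cV_bigcup.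

End measurable_cV.

Lemma measurable_cV_coord (R : realType) (n : nat) (i : 'I_n) :
  measurable_fun [set: 'cV[R]_n] (cV_coord i).
Proof.
move=> _ Y mY; rewrite setTI; apply: sub_sigma_algebra => /=.
rewrite -bigcup_seq/=; exists i => /=; first by rewrite mem_index_enum.
by exists Y => //; rewrite setTI.
Qed.

Lemma measurable_fun_cVP d (T : measurableType d) (R : realType) (n : nat)
    (f : T -> 'cV[R]_n) :
  measurable_fun [set: T] f <->
  forall i, measurable_fun [set: T] (fun x => f x i 0).
Proof.
split=> [mf i|mf].
  exact: (measurableT_comp (@measurable_cV_coord R n i) mf).
move=> _ A mA; move: A mA.
pose G : set (set 'cV[R]_n) := [set A | measurable ([set: T] `&` f @^-1` A)].
suff : g_sigma_preimage (@cV_coord R n) `<=` G by [].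
apply: smallest_sub.
  split=> /=.
  - by rewrite /G /= preimage_set0 setI0.
  - move=> A; rewrite /G /= !setTI setTD preimage_setC; exact: measurableC.
  - move=> F mF; rewrite /G /= preimage_bigcup setI_bigcupr.
    exact: bigcupT_measurable.
rewrite -bigcup_seq; apply: bigcup_sub => i _ A [B mB <-].
by rewrite /G /= setTI -comp_preimage; exact: mf.
Qed.

Section lebesgue_cV_step.
Context (R : realType) (n : nat).
Variable mu : {sigma_finite_measure set 'cV[R]_n -> \bar R}.

Definition cons_cV (p : measurableTypeR R * 'cV[R]_n) : 'cV[R]_n.+1 := col_mx (p.1)%:M p.2.

Lemma measurable_cons_cV : measurable_fun setT cons_cV.
Proof.
apply/measurable_fun_cVP => i.
have [j ij|j ij] := split_ordP (i : 'I_(1 + n)).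
- rewrite (_ : (fun p => _) = fst)//.
  apply/funext => -[a v] /=; rewrite ij ord1.
  by have := col_mxEu a%:M v 0 0; rewrite [in RHS]mxE eqxx mulr1n.
- rewrite (_ : (fun p => _) = cV_coord j \o snd).
    by apply: measurableT_comp => //; exact: measurable_cV_coord.
  by apply/funext => -[a v] /=; rewrite ij; exact: (col_mxEd a%:M v).
Qed.

Definition lebesgue_cVS : set 'cV[R]_n.+1 -> \bar R :=
  pushforward (@lebesgue_measure R \x mu)%E cons_cV.

Let lebesgue_cVS0 : lebesgue_cVS set0 = 0%E.
Proof. by rewrite /lebesgue_cVS /pushforward preimage_set0 measure0. Qed.

Let lebesgue_cVS_ge0 A : (0 <= lebesgue_cVS A)%E.
Proof. by rewrite /lebesgue_cVS /pushforward; exact: measure_ge0. Qed.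

Let lebesgue_cVS_sigma_additive : semi_sigma_additive lebesgue_cVS.
Proof.
move=> F mF tF mUF; rewrite /lebesgue_cVS /pushforward preimage_bigcup.
apply: measure_semi_sigma_additive.
- move=> i; rewrite -[X in measurable X]setTI.
  by apply: measurable_cons_cV => //; exact: mF.
- apply/trivIsetP => /= i j _ _ ij; rewrite -preimage_setI.
  by move/trivIsetP : tF => /(_ _ _ _ _ ij) ->//; rewrite preimage_set0.
- rewrite -preimage_bigcup -[X in measurable X]setTI.
  exact: measurable_cons_cV.
Qed.

HB.instance Definition _ := isMeasure.Build _ _ _ lebesgue_cVS
  lebesgue_cVS0 lebesgue_cVS_ge0 lebesgue_cVS_sigma_additive.

Let lebesgue_cVS_sigma_finite : sigma_finite setT lebesgue_cVS.
Proof.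
have /sigma_finiteP[F [TF ndF Foo]] := sigma_finiteT (@lebesgue_measure R).
have /sigma_finiteP[G [TG ndG Goo]] := sigma_finiteT mu.
pose g (x : 'cV[R]_n.+1) : measurableTypeR R * 'cV[R]_n :=
  (usubmx (x : 'cV[R]_(1 + n)) 0 0, dsubmx (x : 'cV[R]_(1 + n))).
have mg : measurable_fun setT g.
  apply: measurable_fun_pair => /=.
    apply: eq_measurable_fun (measurable_cV_coord (lshift n (0 : 'I_1) : 'I_n.+1)).
    by move=> x _; rewrite mxE.
  apply/measurable_fun_cVP => i.
  apply: eq_measurable_fun (measurable_cV_coord (rshift 1 i : 'I_n.+1)).
  by move=> x _; rewrite mxE.
have gK : g \o cons_cV = id.
  apply/funext => -[a v]; rewrite /g /cons_cV /= col_mxKu col_mxKd.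
  by rewrite mxE eqxx mulr1n.
exists (fun i => g @^-1` (F i `*` G i)).
  apply/esym; rewrite -preimage_bigcup -subTset => x _.
  have [i _ Fi] : (\bigcup_i F i) (g x).1 by rewrite -TF.
  have [j _ Gj] : (\bigcup_i G i) (g x).2 by rewrite -TG.
  exists (maxn i j) => //; split.
  - by exact: ((elimT (subsetPset _ _) (ndF _ _ (leq_maxl i j))) _ Fi).
  - by exact: ((elimT (subsetPset _ _) (ndG _ _ (leq_maxr i j))) _ Gj).
move=> k; have [mF Fk] := Foo k; have [mG Gk] := Goo k; split.
  rewrite -[X in measurable X]setTI; apply: mg => //.
  exact: (measurableX mF mG).
rewrite /lebesgue_cVS /pushforward -comp_preimage gK preimage_id.
by rewrite product_measure1E// lte_mul_pinfty// ge0_fin_numE.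
Qed.

HB.instance Definition _ := Measure_isSigmaFinite.Build _ _ _ lebesgue_cVS
  lebesgue_cVS_sigma_finite.

End lebesgue_cV_step.

(* Product of n copies of the Lebesgue measure of R, by recursion on n along
   (a, v) |-> [a; v]. *)
Fixpoint lebesgue_cV (R : realType) (n : nat) :
    {sigma_finite_measure set 'cV[R]_n -> \bar R} :=
  match n with
  | 0 => @dirac _ 'cV[R]_0 0 R
  | n'.+1 => lebesgue_cVS (lebesgue_cV R n')
  end.

Section gaussian.
Context (R : realType).

Definition posdef (k : nat) (S : 'M[R]_k) : Prop :=
  S^T = S /\ forall u : 'cV[R]_k, u != 0 -> 0 < (u^T *m S *m u) 0 0.

(* N(z; mu, S), as a density with respect to Lebesgue measure; meaningful for
   S positive definite. *)
Definition gauss_pdf (k : nat) (z mu : 'cV[R]_k) (S : 'M[R]_k) : R :=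
  (Num.sqrt ((2 * pi) ^+ k * \det S))^-1 *
  expR (- ((z - mu)^T *m invmx S *m (z - mu)) 0 0 / 2).

Definition gaussian_rv d (Omega : measurableType d) (P : probability Omega R)
    (k : nat) (X : Omega -> 'cV[R]_k) (mu : 'cV[R]_k) (S : 'M[R]_k) : Prop :=
  measurable_fun setT X /\
  forall B : set 'cV[R]_k, measurable B ->
    P (X @^-1` B) = (\int[lebesgue_cV R k]_(z in B) (gauss_pdf z mu S)%:E)%E.

End gaussian.

Section independence.
Context (R : realType) d (Omega : measurableType d) (P : probability Omega R).

Definition sigma_rv (k : nat) (X : Omega -> 'cV[R]_k) : set (set Omega) :=
  preimage_set_system setT X measurable.

Definition mutually_independent (I : choiceType) (F : I -> set (set Omega)) :
    Prop :=
  forall (s : {fset I}) (B : I -> set Omega),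
    (forall i, i \in s -> F i (B i)) ->
    fine (P (\bigcap_(i in [set` s]) B i)) = \prod_(i <- s) fine (P (B i)).

End independence.

Section quantizer.
Context (R : realType) (p : nat).

Definition hyperrectangle (B : set 'cV[R]_p) : Prop :=
  exists I : 'I_p -> interval R, B = [set z | forall j, z j 0 \in I j].

(* The cells and levels are numbered from 0; Lev is {0, ..., L-1} for a finite
   quantizer and all of nat when there are infinitely many levels. *)
Definition is_quantizer (Lev : set nat) (J : nat -> set 'cV[R]_p)
    (eta : nat -> 'cV[R]_p) (q : 'cV[R]_p -> 'cV[R]_p) : Prop :=
  [/\ (exists L : nat, Lev = `I_L) \/ Lev = setT,
      partition Lev J setT,
      forall i, Lev i -> hyperrectangle (J i) &
      forall i z, Lev i -> J i z -> q z = eta i].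

End quantizer.

Section system.
Context (R : realType) (n m p : nat).
Context d (Omega : measurableType d) (P : probability Omega R).

(* Time starts at t = 1, except for the unknown input, which starts at d_0;
   w 0, v 0, x 0, z 0 and y 0 are not used. *)
Record quantized_system (A : 'M[R]_n) (G : 'M[R]_(n, m)) (C : 'M[R]_(p, n))
    (q : 'cV[R]_p -> 'cV[R]_p) (Q : 'M[R]_n) (Rv : 'M[R]_p)
    (mu1 : 'cV[R]_n) (P1 : 'M[R]_n)
    (x w : nat -> Omega -> 'cV[R]_n) (dd : nat -> Omega -> 'cV[R]_m)
    (v z y : nat -> Omega -> 'cV[R]_p) : Prop := QuantizedSystem {
  state_eq : forall t om, (0 < t)%N ->
    x t.+1 om = A *m x t om + G *m dd t om + w t om;
  output_eq : forall t om, (0 < t)%N -> z t om = C *m x t om + v t om;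
  measurement_eq : forall t om, (0 < t)%N -> y t om = q (z t om);
  initial_law : gaussian_rv P (x 1%N) mu1 P1;
  process_noise_law : forall t, (0 < t)%N -> gaussian_rv P (w t) 0 Q;
  output_noise_law : forall t, (0 < t)%N -> gaussian_rv P (v t) 0 Rv;
  noise_independent : mutually_independent P
    (fun i : nat + nat => match i with
       | inl t => sigma_rv (w t.+1)
       | inr t => sigma_rv (v t.+1)
     end) }.

Record iid_gaussian_input (dbar : 'cV[R]_m) (D : 'M[R]_m)
    (dd : nat -> Omega -> 'cV[R]_m) (w : nat -> Omega -> 'cV[R]_n) : Prop :=
  IidGaussianInput {
  input_law : forall t, gaussian_rv P (dd t) dbar D;
  input_independent : mutually_independent P
    (fun i : nat + nat => match i with
       | inl t => sigma_rv (dd t)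
       | inr t => sigma_rv (w t.+1)
     end) }.

End system.

Section bayes_filter.
Context (R : realType) (k : nat).

Definition bayes_update (lik prior : 'cV[R]_k -> R) (x : 'cV[R]_k) : R :=
  lik x * prior x / \int[lebesgue_cV R k]_u (lik u * prior u).

Definition chapman_kolmogorov (trans : 'cV[R]_k -> 'cV[R]_k -> R)
    (post : 'cV[R]_k -> R) (x' : 'cV[R]_k) : R :=
  \int[lebesgue_cV R k]_x (trans x' x * post x).

(* With lik t x = p(y_t | x_t = x), trans x' x = p(x_{t+1} = x' | x_t = x) and
   init = p(x_1):  bayes_pred t = p(x_{t+1} | y_{1:t}) for t >= 0 and
   bayes_filt t = p(x_t | y_{1:t}) for t >= 1. *)
Fixpoint bayes_pred (init : 'cV[R]_k -> R) (lik : nat -> 'cV[R]_k -> R)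
    (trans : 'cV[R]_k -> 'cV[R]_k -> R) (t : nat) : 'cV[R]_k -> R :=
  match t with
  | 0 => init
  | s.+1 => chapman_kolmogorov trans
              (bayes_update (lik s.+1) (bayes_pred init lik trans s))
  end.

Definition bayes_filt (init : 'cV[R]_k -> R) (lik : nat -> 'cV[R]_k -> R)
    (trans : 'cV[R]_k -> 'cV[R]_k -> R) (t : nat) : 'cV[R]_k -> R :=
  bayes_update (lik t) (bayes_pred init lik trans t.-1).

End bayes_filter.

(* The extended state [x_t; d_{t-1}] is an element xe of 'cV[R]_(n + m), with
   x_t = usubmx xe and d_{t-1} = dsubmx xe. *)
Section extended_state.
Context (R : realType) (n m p : nat).

Definition marg_state (f : 'cV[R]_(n + m) -> R) (x : 'cV[R]_n) : R :=
  \int[lebesgue_cV R m]_u f (col_mx x u).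

Definition marg_input (f : 'cV[R]_(n + m) -> R) (u : 'cV[R]_m) : R :=
  \int[lebesgue_cV R n]_x f (col_mx x u).

Definition init_pdf (mu1 : 'cV[R]_n) (P1 : 'M[R]_n)
    (dbar : 'cV[R]_m) (D : 'M[R]_m) (xe : 'cV[R]_(n + m)) : R :=
  gauss_pdf (usubmx xe) mu1 P1 * gauss_pdf (dsubmx xe) dbar D.

Definition trans_pdf (A : 'M[R]_n) (G : 'M[R]_(n, m)) (Q : 'M[R]_n)
    (dbar : 'cV[R]_m) (D : 'M[R]_m) (xe' xe : 'cV[R]_(n + m)) : R :=
  gauss_pdf xe' (col_mx (A *m usubmx xe + G *m dbar) dbar)
    (block_mx (Q + G *m D *m G^T) (G *m D) (D *m G^T) D).

(* The weights phi and offsets mu may depend on the cell of the realized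
   measurement. *)
Definition obs_pdf (C : 'M[R]_(p, n)) (Rv : 'M[R]_p) (K : nat)
    (phi : nat -> R) (zeta : nat -> 'cV[R]_p -> 'cV[R]_p)
    (mu : nat -> 'cV[R]_p) (y : 'cV[R]_p) (x : 'cV[R]_n) : R :=
  \sum_(1 <= kappa < K.+1)
    phi kappa * gauss_pdf (zeta kappa y) (C *m x + mu kappa) Rv.

End extended_state.

(* Mixture parameters.  At time t, the fields *_pred carry the subscript
   t|t-1 and the fields *_filt the subscript t|t, except d_filt and Gamma_filt,
   which carry t-1|t.  Mixture components are numbered from 1. *)
Record gsf_params (R : realType) (n m p : nat) := GsfParams {
  M_pred : nat -> nat;
  M_filt : nat -> nat;
  delta_pred : nat -> nat -> R;
  delta_bar : nat -> nat -> R;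
  delta_filt : nat -> nat -> R;
  x_pred : nat -> nat -> 'cV[R]_n;
  Sigma_pred : nat -> nat -> 'M[R]_n;
  x_filt : nat -> nat -> 'cV[R]_n;
  Sigma_filt : nat -> nat -> 'M[R]_n;
  d_filt : nat -> nat -> 'cV[R]_m;
  Gamma_filt : nat -> nat -> 'M[R]_m;
  K_gain : nat -> nat -> 'M[R]_(n, p);
  L_gain : nat -> nat -> 'M[R]_(m, p) }.

Record gsf_recursion (R : realType) (n m p : nat)
    (A : 'M[R]_n) (G : 'M[R]_(n, m)) (C : 'M[R]_(p, n))
    (Q : 'M[R]_n) (Rv : 'M[R]_p) (mu1 : 'cV[R]_n) (P1 : 'M[R]_n)
    (dbar : 'cV[R]_m) (D : 'M[R]_m) (K : nat)
    (phi : nat -> nat -> R) (zeta : nat -> nat -> 'cV[R]_p -> 'cV[R]_p)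
    (mu : nat -> nat -> 'cV[R]_p) (y : nat -> 'cV[R]_p)
    (S : gsf_params R n m p) : Prop := GsfRecursion {
  gsf_M_init : M_pred S 1 = 1%N;
  gsf_delta_init : delta_pred S 1 1 = 1;
  gsf_x_init : x_pred S 1 1 = mu1;
  gsf_Sigma_init : Sigma_pred S 1 1 = P1;

  gsf_M_filt : forall t, (1 <= t)%N -> M_filt S t = (K * M_pred S t)%N;
  gsf_K_gain : forall t l, (1 <= t)%N -> (1 <= l <= M_pred S t)%N ->
    K_gain S t l = Sigma_pred S t l *m C^T
      *m invmx (Rv + C *m Sigma_pred S t l *m C^T);
  gsf_L_gain : forall t l, (1 <= t)%N -> (1 <= l <= M_pred S t)%N ->
    L_gain S t l = D *m G^T *m C^T
      *m invmx (Rv + C *m Sigma_pred S t l *m C^T);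
  gsf_delta_bar : forall t kappa l k, (1 <= t)%N ->
    (1 <= kappa <= K)%N -> (1 <= l <= M_pred S t)%N ->
    k = (l.-1 * K + kappa)%N ->
    delta_bar S t k = phi t kappa * delta_pred S t l *
      gauss_pdf (zeta t kappa (y t)) (C *m x_pred S t l + mu t kappa)
        (Rv + C *m Sigma_pred S t l *m C^T);
  gsf_delta_filt : forall t k, (1 <= t)%N -> (1 <= k <= M_filt S t)%N ->
    delta_filt S t k =
      delta_bar S t k / \sum_(1 <= r < (M_filt S t).+1) delta_bar S t r;
  gsf_x_filt : forall t kappa l k, (1 <= t)%N ->
    (1 <= kappa <= K)%N -> (1 <= l <= M_pred S t)%N ->
    k = (l.-1 * K + kappa)%N ->
    x_filt S t k = x_pred S t l + K_gain S t l *m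
      (zeta t kappa (y t) - C *m x_pred S t l - mu t kappa);
  gsf_Sigma_filt : forall t kappa l k, (1 <= t)%N ->
    (1 <= kappa <= K)%N -> (1 <= l <= M_pred S t)%N ->
    k = (l.-1 * K + kappa)%N ->
    Sigma_filt S t k = (1%:M - K_gain S t l *m C) *m Sigma_pred S t l;
  gsf_d_filt : forall t kappa l k, (1 <= t)%N ->
    (1 <= kappa <= K)%N -> (1 <= l <= M_pred S t)%N ->
    k = (l.-1 * K + kappa)%N ->
    d_filt S t k = dbar + L_gain S t l *m
      (zeta t kappa (y t) - C *m x_pred S t l - mu t kappa);
  gsf_Gamma_filt : forall t kappa l k, (1 <= t)%N ->
    (1 <= kappa <= K)%N -> (1 <= l <= M_pred S t)%N ->
    k = (l.-1 * K + kappa)%N ->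
    Gamma_filt S t k = (1%:M - L_gain S t l *m C *m G) *m D;

  gsf_M_pred : forall t, (1 <= t)%N -> M_pred S t.+1 = M_filt S t;
  gsf_delta_pred : forall t k, (1 <= t)%N -> (1 <= k <= M_filt S t)%N ->
    delta_pred S t.+1 k = delta_filt S t k;
  gsf_x_pred : forall t k, (1 <= t)%N -> (1 <= k <= M_filt S t)%N ->
    x_pred S t.+1 k = A *m x_filt S t k + G *m dbar;
  gsf_Sigma_pred : forall t k, (1 <= t)%N -> (1 <= k <= M_filt S t)%N ->
    Sigma_pred S t.+1 k =
      Q + G *m D *m G^T + A *m Sigma_filt S t k *m A^T }.

(* Main.v *)
(* Both filtering steps map Gaussian mixtures in [x_t; d_{t-1}] to Gaussian
   mixtures.  The key identity is
     N(z; C x + c, V) N(x; a, S)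
       = N(z; C a + c, V + C S C^T) N(x; a + K (z - C a - c), (I - K C) S)
   with K = S C^T (V + C S C^T)^-1, obtained by factoring the joint density of
   (x, z) along either Schur complement.  It gives the measurement update with
   the observation matrix [C 0], and, after integrating in x, the prediction
   step with the transition matrix [A 0; 0 0].  The only integral needed is
   that of a Gaussian density, computed by peeling off one coordinate at a time.
   Every predicted component has mean [x_pred; dbar] and covariance
   [Sigma_pred, X; X^T, D] with X = G D (X = 0 at t = 1), so that the lower
   blocks of its update are L, d_filt and Gamma_filt. *)

Require Import Defs.
From HB Require Import structures.
From mathcomp Require Import all_boot all_order all_algebra.
From mathcomp Require Import all_classical all_reals all_analysis.
From mathcomp Require Import measurable_realfun ring.

Set Implicit Arguments.
Unset Strict Implicit.
Unset Printing Implicit Defensive.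

Import Order.TTheory GRing.Theory Num.Theory.
Import numFieldNormedType.Exports.

Local Open Scope classical_set_scope.
Local Open Scope ring_scope.

(** * Positive definite matrices, block elimination and Schur complements *)

Section posdef_matrices.
Context {R : realType}.

Lemma posdef_sym k (S : 'M[R]_k) : posdef S -> S^T = S.
Proof. by case. Qed.

Lemma posdef_congr k (E S : 'M[R]_k) :
  E \in unitmx -> posdef S -> posdef (E *m S *m E^T).
Proof.
move=> uE [sS pS]; split; first by rewrite !trmx_mul trmxK sS mulmxA.
move=> u u0.
have -> : u^T *m (E *m S *m E^T) *m u = (E^T *m u)^T *m S *m (E^T *m u).
  by rewrite trmx_mul trmxK !mulmxA.
apply: pS; apply: contra_neq u0 => Eu0.
by rewrite -[u](mulKmx (_ : E^T \in unitmx)) ?unitmx_tr// Eu0 mulmx0.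
Qed.

(** [B] may be rectangular or singular: strictness comes from [S] alone, and the second form is only
    nonnegative. This covers the innovation covariance V + C S C^T and the prediction with a
    singular transition matrix. *)
Lemma posdef_add_congr k l (S : 'M[R]_k) (T : 'M[R]_l) (B : 'M[R]_(k, l)) :
  posdef S -> posdef T -> posdef (S + B *m T *m B^T).
Proof.
move=> [sS pS] [sT pT]; split.
  by rewrite linearD /= !trmx_mul trmxK sS sT mulmxA.
move=> u u0; rewrite mulmxDr mulmxDl mxE ltr_pwDl ?pS//.
rewrite (_ : _ *m _ *m u = (B^T *m u)^T *m T *m (B^T *m u)).
  have [->|Bu0] := eqVneq (B^T *m u) 0; first by rewrite mulmx0 mxE.
  by rewrite ltW// pT.
by rewrite trmx_mul trmxK !mulmxA.
Qed.

Lemma posdef_block_diagP k l (S : 'M[R]_k) (T : 'M[R]_l) :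
  posdef (block_mx S 0 0 T) <-> posdef S /\ posdef T.
Proof.
have quad (u : 'cV[R]_k) (v : 'cV[R]_l) :
    (col_mx u v)^T *m block_mx S 0 0 T *m col_mx u v =
    u^T *m S *m u + v^T *m T *m v.
  by rewrite tr_col_mx mul_row_block !mulmx0 addr0 add0r mul_row_col.
split=> [[sST pST]|[[sS pS] [sT pT]]].
  move: sST; rewrite tr_block_mx !trmx0 => /eq_block_mx[sS _ _ sT].
  split; split=> // u u0.
    have := pST (col_mx u 0); rewrite quad trmx0 !mul0mx addr0; apply.
    by apply: contra_neq u0; rewrite -col_mx0 => /eq_col_mx[].
  have := pST (col_mx 0 u); rewrite quad trmx0 !mul0mx add0r; apply.
  by apply: contra_neq u0; rewrite -col_mx0 => /eq_col_mx[].
split; first by rewrite tr_block_mx !trmx0 sS sT.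
move=> w; rewrite -[w]vsubmxK quad col_mx_eq0 negb_and mxE.
move: (usubmx w) (dsubmx w) => u v /orP[u0|v0].
  rewrite ltr_pwDl ?pS//; have [->|v0] := eqVneq v 0; first by rewrite mulmx0 mxE.
  by rewrite ltW// pT.
rewrite ltr_wpDl ?pT//; have [->|u0] := eqVneq u 0; first by rewrite mulmx0 mxE.
by rewrite ltW// pS.
Qed.

(** Shears. Having determinant 1, they preserve determinants under congruence and hence the
    normalizing constant of a Gaussian density. *)
Definition unilower k l (B : 'M[R]_(l, k)) : 'M[R]_(k + l) :=
  block_mx 1%:M 0 B 1%:M.

Definition uniupper k l (B : 'M[R]_(k, l)) : 'M[R]_(k + l) :=
  block_mx 1%:M B 0 1%:M.

Lemma det_unilower k l (B : 'M[R]_(l, k)) : \det (unilower B) = 1.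
Proof. by rewrite det_lblock !det1 mulr1. Qed.

Lemma det_uniupper k l (B : 'M[R]_(k, l)) : \det (uniupper B) = 1.
Proof. by rewrite det_ublock !det1 mulr1. Qed.

Lemma det1_unitmx k (E : 'M[R]_k) : \det E = 1 -> E \in unitmx.
Proof. by rewrite unitmxE => ->; exact: unitr1. Qed.

Lemma invmx_sym k (S : 'M[R]_k) : S^T = S -> (invmx S)^T = invmx S.
Proof. by move=> sS; rewrite trmx_inv sS. Qed.

(** Symmetric block elimination with pivot [S]: the shear removes the off-diagonal blocks and leaves
    the Schur complement of [S]. [block_UDU] does the same with pivot [T]. *)
Lemma block_LDL k l (S : 'M[R]_k) (X : 'M[R]_(k, l)) (T : 'M[R]_l) :
  S^T = S -> S \in unitmx ->
  block_mx S X X^T T =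
  unilower (X^T *m invmx S)
    *m block_mx S 0 0 (T - X^T *m invmx S *m X)
    *m (unilower (X^T *m invmx S))^T.
Proof.
move=> sS uS; rewrite /unilower tr_block_mx !trmx1 trmx0 trmx_mul trmxK.
rewrite invmx_sym// !mulmx_block.
rewrite !(mul1mx, mul0mx, mulmx1, mulmx0, addr0, add0r).
by rewrite mulmxKV// mulKVmx// mulmxA addrC subrK.
Qed.

Lemma block_UDU k l (S : 'M[R]_k) (X : 'M[R]_(k, l)) (T : 'M[R]_l) :
  T^T = T -> T \in unitmx ->
  block_mx S X X^T T =
  uniupper (X *m invmx T)
    *m block_mx (S - X *m invmx T *m X^T) 0 0 T
    *m (uniupper (X *m invmx T))^T.
Proof.
move=> sT uT; rewrite /uniupper tr_block_mx !trmx1 trmx0 trmx_mul.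
rewrite invmx_sym// !mulmx_block.
rewrite !(mul1mx, mul0mx, mulmx1, mulmx0, addr0, add0r).
by rewrite mulmxKV// mulKVmx// mulmxA subrK.
Qed.

Lemma posdef_congrP k (E S : 'M[R]_k) :
  E \in unitmx -> posdef (E *m S *m E^T) <-> posdef S.
Proof.
move=> uE; split; last exact: posdef_congr.
move=> /(@posdef_congr _ (invmx E)); rewrite unitmx_inv => /(_ uE).
by rewrite !mulmxA mulVmx// mul1mx -mulmxA trmx_inv mulmxV ?unitmx_tr// mulmx1.
Qed.

Lemma posdef_ulsubmx k l (M : 'M[R]_(k + l)) : posdef M -> posdef (ulsubmx M).
Proof.
move=> [sM pM]; split; first by rewrite trmx_ulsub sM.
move=> u u0; have := pM (col_mx u 0).
rewrite -[M]submxK tr_col_mx mul_row_block trmx0 !mul0mx !addr0.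
rewrite mul_row_col mulmx0 addr0 !block_mxKul; apply.
by apply: contra_neq u0; rewrite -col_mx0 => /eq_col_mx[].
Qed.

Lemma posdef_drsubmx k l (M : 'M[R]_(k + l)) : posdef M -> posdef (drsubmx M).
Proof.
move=> [sM pM]; split; first by rewrite trmx_drsub sM.
move=> u u0; have := pM (col_mx 0 u).
rewrite -[M]submxK tr_col_mx mul_row_block trmx0 !mul0mx !add0r.
rewrite mul_row_col mulmx0 add0r !block_mxKdr; apply.
by apply: contra_neq u0; rewrite -col_mx0 => /eq_col_mx[].
Qed.

Lemma posdef_submxK k l (M : 'M[R]_(k + l)) : posdef M ->
  M = block_mx (ulsubmx M) (ursubmx M) (ursubmx M)^T (drsubmx M).
Proof. by move=> [sM _]; rewrite trmx_ursub sM submxK. Qed.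

(** Induction on the dimension: eliminating the first coordinate leaves a smaller positive definite
    Schur complement, and the determinant is the pivot times that of the complement. *)
Lemma posdef_det_gt0 k (S : 'M[R]_k) : posdef S -> 0 < \det S.
Proof.
elim: k S => [S _|k IH]; first by rewrite det_mx00.
rewrite -[k.+1]/(1 + k)%N => S pS.
have pS1 := posdef_ulsubmx pS.
have S1_gt0 : 0 < \det (ulsubmx S).
  have /pS1.2 : (1%:M : 'cV[R]_1) != 0 by exact: oner_neq0.
  by rewrite trmx1 mul1mx mulmx1 det_mx11.
have uS1 : ulsubmx S \in unitmx by rewrite unitmxE unitfE gt_eqF.
move: (pS); rewrite (posdef_submxK pS) (block_LDL _ _ (posdef_sym pS1) uS1).
move/posdef_congrP => /(_ (det1_unitmx (det_unilower _)))/posdef_block_diagP[_ pT].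
by rewrite !det_mulmx det_tr det_unilower mul1r mulr1 det_ublock mulr_gt0// IH.
Qed.

Lemma posdef_unitmx k (S : 'M[R]_k) : posdef S -> S \in unitmx.
Proof. by move=> pS; rewrite unitmxE unitfE gt_eqF// posdef_det_gt0. Qed.

(** Congruence by an invertible shear preserves positive definiteness in both directions, which
    reduces the claim to the block diagonal case. *)
Lemma posdef_schur k l (S : 'M[R]_k) (X : 'M[R]_(k, l)) (T : 'M[R]_l) :
  posdef S ->
  posdef (block_mx S X X^T T) <-> posdef (T - X^T *m invmx S *m X).
Proof.
move=> pS; rewrite (block_LDL _ _ (posdef_sym pS) (posdef_unitmx pS)).
rewrite posdef_congrP ?det1_unitmx ?det_unilower// posdef_block_diagP; tauto.
Qed.

Lemma posdef_schur_dr k l (S : 'M[R]_k) (X : 'M[R]_(k, l)) (T : 'M[R]_l) :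
  posdef T ->
  posdef (block_mx S X X^T T) <-> posdef (S - X *m invmx T *m X^T).
Proof.
move=> pT; rewrite (block_UDU _ _ (posdef_sym pT) (posdef_unitmx pT)).
rewrite posdef_congrP ?det1_unitmx ?det_uniupper// posdef_block_diagP; tauto.
Qed.

End posdef_matrices.

(** * Factorizations of Gaussian densities and the Kalman identity *)

Section gaussian_algebra.
Context {R : realType}.

Lemma gauss_pdf_ge0 k (z mu : 'cV[R]_k) (S : 'M[R]_k) : 0 <= gauss_pdf z mu S.
Proof. by rewrite mulr_ge0 ?invr_ge0 ?sqrtr_ge0 ?expR_ge0. Qed.

Lemma gauss_pdf_sub k (z mu : 'cV[R]_k) (S : 'M[R]_k) :
  gauss_pdf z mu S = gauss_pdf (z - mu) 0 S.
Proof. by rewrite /gauss_pdf subr0. Qed.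

Lemma invmxM k (A B : 'M[R]_k) : A \in unitmx -> B \in unitmx ->
  invmx (A *m B) = invmx B *m invmx A.
Proof.
move=> uA uB; have uAB : A *m B \in unitmx by rewrite unitmx_mul uA.
by apply: (can_inj (mulKmx uAB)); rewrite mulmxV// mulmxA mulmxK// mulmxV.
Qed.

(** The factors [E] cancel in the quadratic form, and the normalizing constant is unchanged because
    [E] has determinant 1. *)
Lemma gauss_pdf_unimodular k (E S : 'M[R]_k) (z mu : 'cV[R]_k) :
  \det E = 1 -> S \in unitmx ->
  gauss_pdf (E *m z) (E *m mu) (E *m S *m E^T) = gauss_pdf z mu S.
Proof.
move=> dE uS; have uE := det1_unitmx dE; have uET : E^T \in unitmx by rewrite unitmx_tr.
rewrite /gauss_pdf !det_mulmx det_tr dE mul1r mulr1 -mulmxBr.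
congr (_ * expR (- (_ 0 0) / 2)).
rewrite invmxM ?unitmx_mul ?uE// invmxM// trmx_mul.
by rewrite !mulmxA mulmxK// -!mulmxA mulKmx.
Qed.

Lemma gauss_pdf_block_diag k l (x a : 'cV[R]_k) (y b : 'cV[R]_l)
    (S : 'M[R]_k) (T : 'M[R]_l) : posdef S -> posdef T ->
  gauss_pdf (col_mx x y) (col_mx a b) (block_mx S 0 0 T) =
  gauss_pdf x a S * gauss_pdf y b T.
Proof.
move=> pS pT; have uS := posdef_unitmx pS; have uT := posdef_unitmx pT.
rewrite /gauss_pdf opp_col_mx add_col_mx det_ublock mulrACA -expRD.
rewrite exprD mulrACA sqrtrM; last first.
  by rewrite mulr_ge0 ?exprn_ge0 ?mulr_ge0 ?pi_ge0 ?ltW ?posdef_det_gt0.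
rewrite invfM; congr (_ * expR _).
rewrite invmx_block_diag ?unitmxE ?det_ublock ?unitrM -?unitmxE ?uS//.
rewrite tr_col_mx mul_row_block !mulmx0 addr0 add0r mul_row_col mxE.
by rewrite -mulrDl opprD.
Qed.

Lemma gauss_pdf_block_congr k l (E : 'M[R]_(k + l)) (x : 'cV[R]_k) (y : 'cV[R]_l)
    (S : 'M[R]_k) (T : 'M[R]_l) : \det E = 1 -> posdef S -> posdef T ->
  gauss_pdf (E *m col_mx x y) 0 (E *m block_mx S 0 0 T *m E^T) =
  gauss_pdf x 0 S * gauss_pdf y 0 T.
Proof.
move=> dE pS pT; rewrite -(gauss_pdf_block_diag x 0 y 0 pS pT) col_mx0.
rewrite -(gauss_pdf_unimodular (col_mx x y) 0 dE) ?mulmx0//.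
by apply: posdef_unitmx; apply/posdef_block_diagP.
Qed.

(** The chain rule p(x, y) = p(x) p(y|x): the shear sends x - a and the residual of y given x to the
    centred pair (x - a, y - b), and turns the block diagonal covariance into the joint one. *)
Lemma gauss_pdf_condr k l (x a : 'cV[R]_k) (y b : 'cV[R]_l)
    (S : 'M[R]_k) (X : 'M[R]_(k, l)) (T : 'M[R]_l) :
  posdef S -> posdef (T - X^T *m invmx S *m X) ->
  gauss_pdf (col_mx x y) (col_mx a b) (block_mx S X X^T T) =
  gauss_pdf x a S *
  gauss_pdf y (b + X^T *m invmx S *m (x - a)) (T - X^T *m invmx S *m X).
Proof.
move=> pS pT; rewrite gauss_pdf_sub (gauss_pdf_sub x) (gauss_pdf_sub y).
rewrite -(gauss_pdf_block_congr _ _ (det_unilower (X^T *m invmx S)) pS pT).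
rewrite -block_LDL ?posdef_sym ?posdef_unitmx//.
rewrite opp_col_mx add_col_mx opprD addrA [in RHS]mul_block_col !mul1mx mul0mx addr0.
by rewrite [_ *m _ + _]addrC subrK.
Qed.

(** The chain rule in the other order, p(x, y) = p(y) p(x|y). *)
Lemma gauss_pdf_condl k l (x a : 'cV[R]_k) (y b : 'cV[R]_l)
    (S : 'M[R]_k) (X : 'M[R]_(k, l)) (T : 'M[R]_l) :
  posdef T -> posdef (S - X *m invmx T *m X^T) ->
  gauss_pdf (col_mx x y) (col_mx a b) (block_mx S X X^T T) =
  gauss_pdf y b T *
  gauss_pdf x (a + X *m invmx T *m (y - b)) (S - X *m invmx T *m X^T).
Proof.
move=> pT pS; rewrite gauss_pdf_sub (gauss_pdf_sub x) (gauss_pdf_sub y) mulrC.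
rewrite -(gauss_pdf_block_congr _ _ (det_uniupper (X *m invmx T)) pS pT).
rewrite -block_UDU ?posdef_sym ?posdef_unitmx//.
rewrite opp_col_mx add_col_mx opprD addrA [in RHS]mul_block_col !mul1mx mul0mx add0r.
by rewrite subrK.
Qed.

Definition kalman_gain k l (S : 'M[R]_k) (C : 'M[R]_(l, k)) (V : 'M[R]_l) :
    'M[R]_(k, l) :=
  S *m C^T *m invmx (V + C *m S *m C^T).

(** The block matrix is the covariance of x and z = C x + noise. Regressing z on x gives back the
    coefficient [C] and the residual covariance [V], whence positive definiteness by the Schur
    criterion. *)
Lemma kalman_joint k l (S : 'M[R]_k) (C : 'M[R]_(l, k)) (V : 'M[R]_l) :
  posdef S -> posdef V ->
  [/\ (S *m C^T)^T *m invmx S = C,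
      V + C *m S *m C^T - (S *m C^T)^T *m invmx S *m (S *m C^T) = V &
      posdef (block_mx S (S *m C^T) (S *m C^T)^T (V + C *m S *m C^T))].
Proof.
move=> pS pV; have gainE : (S *m C^T)^T *m invmx S = C.
  by rewrite trmx_mul trmxK posdef_sym// mulmxK ?posdef_unitmx.
have schurE : V + C *m S *m C^T - (S *m C^T)^T *m invmx S *m (S *m C^T) = V.
  by rewrite gainE mulmxA addrK.
by split=> //; apply/(posdef_schur _ _ pS); rewrite schurE.
Qed.

Lemma kalman_covE k l (S : 'M[R]_k) (C : 'M[R]_(l, k)) (V : 'M[R]_l) :
  posdef S ->
  S - S *m C^T *m invmx (V + C *m S *m C^T) *m (S *m C^T)^T =
  (1%:M - kalman_gain S C V *m C) *m S.
Proof.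
by move=> pS; rewrite trmx_mul trmxK posdef_sym// mulmxBl mul1mx !mulmxA.
Qed.

(** The updated covariance is the Schur complement of the observation block in the joint
    covariance. *)
Lemma posdef_kalman_cov k l (S : 'M[R]_k) (C : 'M[R]_(l, k)) (V : 'M[R]_l) :
  posdef S -> posdef V -> posdef ((1%:M - kalman_gain S C V *m C) *m S).
Proof.
move=> pS pV; have [_ _ pM] := kalman_joint C pS pV; rewrite -kalman_covE//.
by apply/posdef_schur_dr => //; exact: posdef_add_congr.
Qed.

(* Both sides factor the joint density of x ~ N(a, S) and z = C x + c + noise. *)
Lemma gauss_pdf_kalman k l (S : 'M[R]_k) (C : 'M[R]_(l, k)) (V : 'M[R]_l)
    (x a : 'cV[R]_k) (z c : 'cV[R]_l) : posdef S -> posdef V ->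
  gauss_pdf z (C *m x + c) V * gauss_pdf x a S =
  gauss_pdf z (C *m a + c) (V + C *m S *m C^T) *
  gauss_pdf x (a + kalman_gain S C V *m (z - C *m a - c))
    ((1%:M - kalman_gain S C V *m C) *m S).
Proof.
move=> pS pV; have [gainE schurE pM] := kalman_joint C pS pV.
have pW := posdef_add_congr C pV pS.
have pP : posdef (S - S *m C^T *m invmx (V + C *m S *m C^T) *m (S *m C^T)^T).
  by apply/posdef_schur_dr.
have pV' : posdef (V + C *m S *m C^T - (S *m C^T)^T *m invmx S *m (S *m C^T)).
  by rewrite schurE.
have := etrans (esym (gauss_pdf_condr x a z (C *m a + c) pS pV'))
  (gauss_pdf_condl x a z (C *m a + c) pW pP).
rewrite schurE gainE.
rewrite (kalman_covE C V pS).
rewrite [C *m (x - a)]mulmxBr.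
by rewrite [C *m a + c + _]addrC subrKA opprD addrA mulrC.
Qed.

End gaussian_algebra.

(** * Integrals of Gaussian densities and of their mixtures *)

Section gaussian_integral.
Context {R : realType}.

Lemma measurable_gauss_pdf k (mu : 'cV[R]_k) (S : 'M[R]_k) :
  measurable_fun setT (fun z : 'cV[R]_k => gauss_pdf z mu S).
Proof.
have mc i : measurable_fun setT (fun z : 'cV[R]_k => z i 0 - mu i 0).
  by apply: measurable_funB => //; exact: measurable_cV_coord.
(* The sigma-algebra is generated by the coordinates, so the quadratic form is expanded into finite
   sums of products of coordinates. *)
have mq : measurable_fun setT (fun z : 'cV[R]_k =>
    \sum_j (\sum_i (z i 0 - mu i 0) * invmx S i j) * (z j 0 - mu j 0)).
  apply: measurable_sum => j; apply: measurable_funM; last exact: mc.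
  by apply: measurable_sum => i; apply: measurable_funM.
apply: (eq_measurable_fun (fun z : 'cV[R]_k =>
  (Num.sqrt ((2 * pi) ^+ k * \det S))^-1 *
  expR (- (\sum_j (\sum_i (z i 0 - mu i 0) * invmx S i j) * (z j 0 - mu j 0)) / 2))).
  move=> z _; rewrite /gauss_pdf; congr (_ * expR (- _ / 2)).
  rewrite mxE; apply: eq_bigr => j _; rewrite !mxE; congr (_ * _).
  by apply: eq_bigr => i _; rewrite !mxE.
apply: measurable_funM => //; apply: measurableT_comp => //.
by apply: measurable_funM => //; exact: measurableT_comp.
Qed.

(** [normal_pdf] takes a standard deviation, hence the square root of the variance. *)
Lemma gauss_pdf_normal_pdf (z mu : 'cV[R]_1) (S : 'M[R]_1) : 0 < S 0 0 ->
  gauss_pdf z mu S = normal_pdf (mu 0 0) (Num.sqrt (S 0 0)) (z 0 0).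
Proof.
move=> S0; rewrite normal_pdfE ?gt_eqF ?sqrtr_gt0//.
rewrite /gauss_pdf /normal_peak /normal_fun sqr_sqrtr ?ltW//.
rewrite det_mx11 expr1 [S in invmx S]mx11_scalar invmx_scalar mul_mx_scalar.
rewrite -scalemxAl !mxE big_ord1 !mxE; congr (_^-1 * expR _).
  by congr Num.sqrt; rewrite -mulr_natl; ring.
by field; rewrite ?gt_eqF.
Qed.

(** Change of variables along [cons_cV], then Tonelli for the product measure. *)
Lemma integral_lebesgue_cVS k (f : 'cV[R]_k.+1 -> R) :
  measurable_fun setT f -> (forall x, 0 <= f x) ->
  (\int[lebesgue_cV R k.+1]_x (f x)%:E =
   \int[lebesgue_measure]_a \int[lebesgue_cV R k]_v
     (f (col_mx (a%:M : 'cV[R]_1) v))%:E)%E.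
Proof.
move=> mf f0.
have mcons := @measurable_cons_cV R k.
transitivity (\int[(@lebesgue_measure R \x lebesgue_cV R k)%E]_p
    (f (cons_cV p))%:E)%E.
  rewrite (ge0_integral_pushforward mcons)//.
    exact/measurable_EFinP.
  by move=> x _; rewrite lee_fin.
rewrite fubini_tonelli1//.
  by apply/measurable_EFinP; exact: measurableT_comp.
by move=> x; rewrite lee_fin.
Qed.

Lemma integral_gauss_pdf k (mu : 'cV[R]_k) (S : 'M[R]_k) : posdef S ->
  (\int[lebesgue_cV R k]_x (gauss_pdf x mu S)%:E = 1)%E.
Proof.
elim: k mu S => [|k IH] mu S pS.
  (* In dimension 0 the measure is a Dirac mass and the density equals 1. *)
  rewrite integral_dirac//; last first.
    by apply/measurable_EFinP; exact: measurable_gauss_pdf.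
  rewrite diracE in_setT mul1e /gauss_pdf det_mx00 expr0 mulr1 sqrtr1 invr1 mul1r.
  by rewrite mxE big_ord0 oppr0 mul0r expR0.
rewrite integral_lebesgue_cVS; last 2 first.
- exact: measurable_gauss_pdf.
- by move=> x; exact: gauss_pdf_ge0.
move: mu S pS; rewrite -[k.+1]/(1 + k)%N => mu S pS.
have pS1 := posdef_ulsubmx pS.
have S1_gt0 : 0 < ulsubmx S 0 0 by rewrite -det_mx11 posdef_det_gt0.
have pT : posdef (drsubmx S - (ursubmx S)^T *m invmx (ulsubmx S) *m ursubmx S).
  by apply/(posdef_schur _ _ pS1); rewrite -posdef_submxK.
(* The target 1 is written as the integral of the marginal density of the first coordinate; it
   remains to match the integrands. *)
rewrite -[RHS](integral_normal_pdf (usubmx mu 0 0) (Num.sqrt (ulsubmx S 0 0))).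
apply: eq_integral => a _.
(* Given the first coordinate, the others have a Gaussian conditional density, whose integral is 1
   by induction. *)
under eq_integral => v _.
  rewrite -[mu in gauss_pdf _ mu _]vsubmxK [in gauss_pdf _ _ S](posdef_submxK pS).
  rewrite (gauss_pdf_condr _ _ _ _ pS1 pT) EFinM.
  over.
rewrite ge0_integralZl//; first last.
- by rewrite lee_fin gauss_pdf_ge0.
- by move=> x _; rewrite lee_fin gauss_pdf_ge0.
- by apply/measurable_EFinP; exact: measurable_gauss_pdf.
have aE : (a%:M : 'cV[R]_1) 0 0 = a by rewrite mxE eqxx mulr1n.
by rewrite IH// mule1 gauss_pdf_normal_pdf// aE.
Qed.

Lemma integrable_gauss_pdf k (mu : 'cV[R]_k) (S : 'M[R]_k) : posdef S ->
  (lebesgue_cV R k).-integrable setT (fun x => (gauss_pdf x mu S)%:E).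
Proof.
move=> pS; apply/integrableP; split.
  by apply/measurable_EFinP; exact: measurable_gauss_pdf.
under eq_integral do rewrite gee0_abs ?lee_fin ?gauss_pdf_ge0//.
by rewrite integral_gauss_pdf// ltry.
Qed.

Lemma Rintegral_gauss_mixture k (I : eqType) (s : seq I) (c : I -> R)
    (mu : I -> 'cV[R]_k) (S : I -> 'M[R]_k) :
  (forall i, i \in s -> posdef (S i)) ->
  \int[lebesgue_cV R k]_x (\sum_(i <- s) c i * gauss_pdf x (mu i) (S i)) =
  \sum_(i <- s) c i.
Proof.
have intc (i : I) : posdef (S i) -> (lebesgue_cV R k).-integrable setT
    (EFin \o (fun x => c i * gauss_pdf x (mu i) (S i))).
  move=> pS; rewrite (_ : _ \o _ = fun x => (c i)%:E * (gauss_pdf x (mu i) (S i))%:E)%E//.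
  by apply: integrableZl => //; exact: integrable_gauss_pdf.
elim: s => [|i s IH] pS.
  under eq_Rintegral do rewrite big_nil.
  by rewrite big_nil /Rintegral integral0.
have pi : posdef (S i) by apply: pS; rewrite mem_head.
have ps j : j \in s -> posdef (S j) by move=> js; apply: pS; rewrite inE js orbT.
under eq_Rintegral do rewrite big_cons.
rewrite RintegralD//; [|exact: intc|].
  rewrite RintegralZl//; last exact: integrable_gauss_pdf.
  by rewrite {1}/Rintegral integral_gauss_pdf//= mulr1 IH// big_cons.
rewrite (_ : _ \o _ = fun x => \sum_(i <- s) (c i * gauss_pdf x (mu i) (S i))%:E)%E; last first.
  by apply/funext => x /=; rewrite sumEFin.
(* The added condition [i \in s] makes positive definiteness available for each term of the sum. *)
rewrite (_ : (fun x => _) = fun x =>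
    \sum_(i <- s | i \in s) (c i * gauss_pdf x (mu i) (S i))%:E)%E; last first.
  by apply/funext => x; rewrite [RHS]big_seq_cond [LHS]big_seq; apply: eq_bigl => j; rewrite andbb.
by apply: integrable_sum => // j js; apply/intc/ps.
Qed.

End gaussian_integral.

(** * Gaussian mixtures under Bayes updates, prediction and marginalization *)

Section mixtures.
Context {R : realType}.

(** Each density has mass 1, so the normalizing integral is the sum of the weights. *)
Lemma bayes_update_mixture k (I : eqType) (s : seq I) (c : I -> R)
    (mu : I -> 'cV[R]_k) (S : I -> 'M[R]_k) (lik prior : 'cV[R]_k -> R) x :
  (forall i, i \in s -> posdef (S i)) ->
  (forall u, lik u * prior u = \sum_(i <- s) c i * gauss_pdf u (mu i) (S i)) ->
  bayes_update lik prior x =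
  \sum_(i <- s) c i / (\sum_(j <- s) c j) * gauss_pdf x (mu i) (S i).
Proof.
move=> pS likE; rewrite /bayes_update likE.
under eq_Rintegral do rewrite likE.
rewrite (Rintegral_gauss_mixture c mu pS) mulr_suml; apply: eq_bigr => i _.
by rewrite mulrAC.
Qed.

Lemma chapman_kolmogorov_mixture k (I : eqType) (s : seq I) (c : I -> R)
    (a : I -> 'cV[R]_k) (S : I -> 'M[R]_k) (T W : 'M[R]_k) (b x' : 'cV[R]_k)
    (trans : 'cV[R]_k -> 'cV[R]_k -> R) (post : 'cV[R]_k -> R) :
  posdef W -> (forall i, i \in s -> posdef (S i)) ->
  (forall z x, trans z x = gauss_pdf z (T *m x + b) W) ->
  (forall x, post x = \sum_(i <- s) c i * gauss_pdf x (a i) (S i)) ->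
  chapman_kolmogorov trans post x' =
  \sum_(i <- s) c i * gauss_pdf x' (T *m a i + b) (W + T *m S i *m T^T).
Proof.
move=> pW pS transE postE; rewrite /chapman_kolmogorov.
(* The right-hand side is read as the total weight of a mixture in the old state x, whose components
   are the laws of x given x'. The Kalman identity, with x' as the observation and [W] as its noise,
   then equates the integrands. *)
rewrite -(Rintegral_gauss_mixture _ 
  (fun i => a i + kalman_gain (S i) T W *m (x' - T *m a i - b))
  (S := fun i => (1%:M - kalman_gain (S i) T W *m T) *m S i)); last first.
  by move=> i /pS pSi; exact: posdef_kalman_cov.
apply: eq_Rintegral => x _; rewrite transE postE mulr_sumr.
apply: eq_big_seq => i /pS pSi.
rewrite mulrCA -[RHS]mulrA.
exact: (congr1 ( *%R (c i)) (gauss_pdf_kalman T x (a i) x' b pSi pW)).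
Qed.

(** The exact conditional mean does not matter for marginalization: a normalized Gaussian in [u] for
    each fixed [x] is enough. *)
Lemma gauss_pdf_factor_state n m (a : 'cV[R]_(n + m)) (S : 'M[R]_(n + m)) :
  posdef S ->
  exists (b : 'cV[R]_n -> 'cV[R]_m) (T : 'M[R]_m), posdef T /\
  forall x u, gauss_pdf (col_mx x u) a S =
    gauss_pdf x (usubmx a) (ulsubmx S) * gauss_pdf u (b x) T.
Proof.
move=> pS; have pS1 := posdef_ulsubmx pS.
have pT := pS; rewrite (posdef_submxK pS) in pT.
move/(posdef_schur _ _ pS1) in pT.
exists (fun x => dsubmx a + (ursubmx S)^T *m invmx (ulsubmx S) *m (x - usubmx a)).
eexists; split; first exact: pT.
move=> x u; rewrite -(gauss_pdf_condr x (usubmx a) u (dsubmx a) pS1 pT).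
by rewrite vsubmxK -(posdef_submxK pS).
Qed.

Lemma gauss_pdf_factor_input n m (a : 'cV[R]_(n + m)) (S : 'M[R]_(n + m)) :
  posdef S ->
  exists (b : 'cV[R]_m -> 'cV[R]_n) (T : 'M[R]_n), posdef T /\
  forall x u, gauss_pdf (col_mx x u) a S =
    gauss_pdf u (dsubmx a) (drsubmx S) * gauss_pdf x (b u) T.
Proof.
move=> pS; have pS2 := posdef_drsubmx pS.
have pT := pS; rewrite (posdef_submxK pS) in pT.
move/(posdef_schur_dr _ _ pS2) in pT.
exists (fun u => usubmx a + ursubmx S *m invmx (drsubmx S) *m (u - dsubmx a)).
eexists; split; first exact: pT.
move=> x u; rewrite -(gauss_pdf_condl x (usubmx a) u (dsubmx a) pS2 pT).
by rewrite vsubmxK -(posdef_submxK pS).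
Qed.

Lemma marg_state_mixture n m (I : eqType) (s : seq I) (c : I -> R)
    (a : I -> 'cV[R]_(n + m)) (S : I -> 'M[R]_(n + m))
    (f : 'cV[R]_(n + m) -> R) x :
  (forall i, i \in s -> posdef (S i)) ->
  (forall xe, f xe = \sum_(i <- s) c i * gauss_pdf xe (a i) (S i)) ->
  marg_state f x =
  \sum_(i <- s) c i * gauss_pdf x (usubmx (a i)) (ulsubmx (S i)).
Proof.
move=> pS fE; rewrite /marg_state.
(* At the fixed [x], choose the conditional mean and covariance of every component; the pair of
   zeros is a dummy for indices outside [s]. *)
have /choice[h hP] (i : I) : exists h : 'cV[R]_m * 'M[R]_m, i \in s ->
    posdef h.2 /\ forall u, gauss_pdf (col_mx x u) (a i) (S i) =
      gauss_pdf x (usubmx (a i)) (ulsubmx (S i)) * gauss_pdf u h.1 h.2.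
  have [is_|_] := boolP (i \in s); last by exists (0, 0).
  have [b [T [pT E]]] := gauss_pdf_factor_state (a i) (pS i is_).
  by exists (b x, T).
rewrite -(Rintegral_gauss_mixture _ (fun i => (h i).1) (S := fun i => (h i).2)); last first.
  by move=> i /hP[].
apply: eq_Rintegral => u _; rewrite fE; apply: eq_big_seq => i /hP[_ E].
by rewrite E mulrA.
Qed.

Lemma marg_input_mixture n m (I : eqType) (s : seq I) (c : I -> R)
    (a : I -> 'cV[R]_(n + m)) (S : I -> 'M[R]_(n + m))
    (f : 'cV[R]_(n + m) -> R) u :
  (forall i, i \in s -> posdef (S i)) ->
  (forall xe, f xe = \sum_(i <- s) c i * gauss_pdf xe (a i) (S i)) ->
  marg_input f u =
  \sum_(i <- s) c i * gauss_pdf u (dsubmx (a i)) (drsubmx (S i)).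
Proof.
move=> pS fE; rewrite /marg_input.
have /choice[h hP] (i : I) : exists h : 'cV[R]_n * 'M[R]_n, i \in s ->
    posdef h.2 /\ forall x, gauss_pdf (col_mx x u) (a i) (S i) =
      gauss_pdf u (dsubmx (a i)) (drsubmx (S i)) * gauss_pdf x h.1 h.2.
  have [is_|_] := boolP (i \in s); last by exists (0, 0).
  have [b [T [pT E]]] := gauss_pdf_factor_input (a i) (pS i is_).
  by exists (b u, T).
rewrite -(Rintegral_gauss_mixture _ (fun i => (h i).1) (S := fun i => (h i).2)); last first.
  by move=> i /hP[].
apply: eq_Rintegral => x _; rewrite fE; apply: eq_big_seq => i /hP[_ E].
by rewrite E mulrA.
Qed.

(** With [node_index], the inverse of the numbering k = (l - 1) K + kappa, all indices starting from
    1. *)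
Definition prior_index (K k : nat) : nat := (k.-1 %/ K).+1.
Definition node_index (K k : nat) : nat := (k.-1 %% K).+1.

Lemma mixture_indexP (K M k : nat) : (1 <= k <= K * M)%N ->
  [/\ (1 <= prior_index K k <= M)%N, (1 <= node_index K k <= K)%N &
      k = ((prior_index K k).-1 * K + node_index K k)%N].
Proof.
case: k => [//|k] /= kM; have K0 : (0 < K)%N by case: K kM.
split; first by rewrite /prior_index /= ltn_divLR// mulnC.
- by rewrite /node_index /= ltn_mod.
- by rewrite /prior_index /node_index /= addnS -divn_eq.
Qed.

(** Induction on [M]: one more prior component appends a block of [K] consecutive indices. *)
Lemma mixture_reindex (K M : nat) (F : nat -> nat -> R) :
  \sum_(1 <= l < M.+1) \sum_(1 <= kappa < K.+1) F l kappa =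
  \sum_(1 <= k < (K * M).+1) F (prior_index K k) (node_index K k).
Proof.
rewrite big_add1 [RHS]big_add1 /=.
elim: M => [|M IH]; first by rewrite muln0 !big_geq.
rewrite big_nat_recr//= IH mulnSr [RHS](big_cat_nat (n := (K * M)%N))//= ?leq_addr//.
congr (_ + _); rewrite big_add1 -[(K * M)%N in RHS]add0n big_addn addKn.
apply: eq_big_nat => i /= iK; have K0 := leq_ltn_trans (leq0n i) iK.
(* In the last block k - 1 = M K + i with i < K, so the quotient is M and the remainder i. *)
rewrite /prior_index /node_index /= addnC mulnC divnMDl// modnMDl.
by rewrite divn_small// modn_small// addn0.
Qed.

End mixtures.

(** * The filter recursion for the extended state *)

Section gaussian_sum_filter.
Context {R : realType} {n m p : nat}.
Context (A : 'M[R]_n) (G : 'M[R]_(n, m)) (C : 'M[R]_(p, n)).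
Context (Q : 'M[R]_n) (Rv : 'M[R]_p) (mu1 : 'cV[R]_n) (P1 : 'M[R]_n).
Context (dbar : 'cV[R]_m) (D : 'M[R]_m) (K : nat) (phi : nat -> nat -> R).
Context (zeta : nat -> nat -> 'cV[R]_p -> 'cV[R]_p) (mu : nat -> nat -> 'cV[R]_p).
Context (y : nat -> 'cV[R]_p) (gsf : gsf_params R n m p).
Context (hQ : posdef Q) (hRv : posdef Rv) (hP1 : posdef P1) (hD : posdef D).
Context (hgsf : gsf_recursion A G C Q Rv mu1 P1 dbar D K phi zeta mu y gsf).

Let init := init_pdf mu1 P1 dbar D.
Let trans := trans_pdf A G Q dbar D.
Let lik := fun t (xe : 'cV[R]_(n + m)) =>
  obs_pdf C Rv K (phi t) (zeta t) (mu t) (y t) (usubmx xe).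
Let pred := bayes_pred init lik trans.
Let filt := bayes_filt init lik trans.

Let Cx : 'M[R]_(p, n + m) := row_mx C 0.

(* Cov(x_{s+1}, d_s | y_{1:s}) of every component: x_1 and d_0 are independent,
   afterwards x_{s+1} contains the term G d_s. *)
Definition pred_cross (s : nat) : 'M[R]_(n, m) := if s is 0 then 0 else G *m D.

(** The index [s] counts processed measurements: component [l] belongs to p([x_{s+1}; d_s] |
    y_{1:s}), that is, to [pred s], while the recursion stores its parameters at time [s.+1]. *)
Definition pred_mean (s l : nat) : 'cV[R]_(n + m) :=
  col_mx (x_pred gsf s.+1 l) dbar.

Definition pred_cov (s l : nat) : 'M[R]_(n + m) :=
  block_mx (Sigma_pred gsf s.+1 l) (pred_cross s) (pred_cross s)^T D.

Definition filt_gain (s l : nat) : 'M[R]_(n + m, p) :=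
  kalman_gain (pred_cov s l) Cx Rv.

Definition filt_mean (s k : nat) : 'cV[R]_(n + m) :=
  let l := prior_index K k in let kappa := node_index K k in
  pred_mean s l + filt_gain s l *m
    (zeta s.+1 kappa (y s.+1) - Cx *m pred_mean s l - mu s.+1 kappa).

Definition filt_cov (s k : nat) : 'M[R]_(n + m) :=
  let l := prior_index K k in (1%:M - filt_gain s l *m Cx) *m pred_cov s l.

Lemma obs_pred_mean s l : Cx *m pred_mean s l = C *m x_pred gsf s.+1 l.
Proof. by rewrite mul_row_col mul0mx addr0. Qed.

Lemma obs_pred_cov s l :
  Cx *m pred_cov s l *m Cx^T = C *m Sigma_pred gsf s.+1 l *m C^T.
Proof.
by rewrite mul_row_block !mul0mx !addr0 tr_row_mx mul_row_col trmx0 mulmx0 addr0.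
Qed.

Lemma filt_gainE s l : (1 <= l <= M_pred gsf s.+1)%N ->
  filt_gain s l = col_mx (K_gain gsf s.+1 l)
    ((pred_cross s)^T *m C^T *m
       invmx (Rv + C *m Sigma_pred gsf s.+1 l *m C^T)).
Proof.
move=> lM; rewrite (gsf_K_gain hgsf)// /filt_gain /kalman_gain obs_pred_cov.
by rewrite tr_row_mx mul_block_col trmx0 !mulmx0 !addr0 mul_col_mx.
Qed.

(** For s > 0 the cross covariance is G D, and (G D)^T = D G^T by symmetry of [D]. At s = 0 it
    vanishes, so the lower gain is 0 instead of [L_gain]; the formulas for the input therefore start
    at time 2. *)
Lemma filt_gain_input s l : (0 < s)%N -> (1 <= l <= M_pred gsf s.+1)%N ->
  dsubmx (filt_gain s l) = L_gain gsf s.+1 l.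
Proof.
case: s => // s _ lM; rewrite filt_gainE// col_mxKd (gsf_L_gain hgsf)//=.
by rewrite trmx_mul (posdef_sym hD).
Qed.

Lemma filt_covE s k : (1 <= prior_index K k <= M_pred gsf s.+1)%N ->
  let l := prior_index K k in
  filt_cov s k = block_mx
    ((1%:M - K_gain gsf s.+1 l *m C) *m Sigma_pred gsf s.+1 l)
    ((1%:M - K_gain gsf s.+1 l *m C) *m pred_cross s)
    ((pred_cross s)^T - dsubmx (filt_gain s l) *m C *m Sigma_pred gsf s.+1 l)
    (D - dsubmx (filt_gain s l) *m C *m pred_cross s).
Proof.
move=> lM /=; rewrite /filt_cov filt_gainE// col_mxKd mul_col_row !mulmx0.
rewrite [1%:M in LHS]scalar_mx_block opp_block_mx add_block_mx mulmx_block.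
by rewrite !oppr0 !addr0 !add0r !mul0mx !addr0 !mul1mx !mulNmx
  [- _ + _]addrC [- _ + D]addrC.
Qed.

Lemma filt_mean_state s k : (1 <= k <= M_filt gsf s.+1)%N ->
  usubmx (filt_mean s k) = x_filt gsf s.+1 k.
Proof.
rewrite (gsf_M_filt hgsf)// => /mixture_indexP[lM kapM kE].
rewrite (gsf_x_filt hgsf _ kapM lM kE)// linearD /= col_mxKu obs_pred_mean.
by rewrite filt_gainE// mul_col_mx col_mxKu.
Qed.

Lemma filt_cov_state s k : (1 <= k <= M_filt gsf s.+1)%N ->
  ulsubmx (filt_cov s k) = Sigma_filt gsf s.+1 k.
Proof.
rewrite (gsf_M_filt hgsf)// => /mixture_indexP[lM kapM kE].
by rewrite (gsf_Sigma_filt hgsf _ kapM lM kE)// filt_covE// block_mxKul.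
Qed.

Lemma filt_mean_input s k : (0 < s)%N -> (1 <= k <= M_filt gsf s.+1)%N ->
  dsubmx (filt_mean s k) = d_filt gsf s.+1 k.
Proof.
move=> s0; rewrite (gsf_M_filt hgsf)// => /mixture_indexP[lM kapM kE].
rewrite (gsf_d_filt hgsf _ kapM lM kE)// linearD /= col_mxKd obs_pred_mean.
by rewrite -(filt_gain_input s0 lM) mul_dsub_mx.
Qed.

Lemma filt_cov_input s k : (0 < s)%N -> (1 <= k <= M_filt gsf s.+1)%N ->
  drsubmx (filt_cov s k) = Gamma_filt gsf s.+1 k.
Proof.
move=> s0; rewrite (gsf_M_filt hgsf)// => /mixture_indexP[lM kapM kE].
rewrite (gsf_Gamma_filt hgsf _ kapM lM kE)// filt_covE// block_mxKdr.
rewrite filt_gain_input//; case: s s0 {lM kapM kE} => // s _ /=.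
by rewrite mulmxBl mul1mx !mulmxA.
Qed.

(** Positive definiteness is part of the invariant because the Kalman identity and the integrals
    rely on it at every step. *)
Definition pred_mixture (s : nat) : Prop :=
  (forall l, (1 <= l <= M_pred gsf s.+1)%N -> posdef (pred_cov s l)) /\
  (forall xe, pred s xe = \sum_(1 <= l < (M_pred gsf s.+1).+1)
     delta_pred gsf s.+1 l * gauss_pdf xe (pred_mean s l) (pred_cov s l)).

Definition filt_mixture (s : nat) : Prop :=
  (forall k, (1 <= k <= M_filt gsf s.+1)%N -> posdef (filt_cov s k)) /\
  (forall xe, filt s.+1 xe = \sum_(1 <= k < (M_filt gsf s.+1).+1)
     delta_filt gsf s.+1 k * gauss_pdf xe (filt_mean s k) (filt_cov s k)).

Lemma pred_mixture0 : pred_mixture 0.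
Proof.
split=> [l|xe]; rewrite (gsf_M_init hgsf).
  rewrite -eqn_leq => /eqP <-; rewrite /pred_cov (gsf_Sigma_init hgsf) trmx0.
  exact/posdef_block_diagP.
rewrite big_nat1 (gsf_delta_init hgsf) mul1r /pred_mean /pred_cov.
rewrite (gsf_x_init hgsf) (gsf_Sigma_init hgsf) trmx0 /pred /= /init /init_pdf.
by rewrite -(gauss_pdf_block_diag _ _ _ _ hP1 hD) vsubmxK.
Qed.

Lemma pred_filt_mixture s : pred_mixture s -> filt_mixture s.
Proof.
move=> [pS predE]; have ME := gsf_M_filt hgsf (ltn0Sn s).
have pF k : (1 <= k <= M_filt gsf s.+1)%N -> posdef (filt_cov s k).
  by rewrite ME => /mixture_indexP[lM _ _]; apply: posdef_kalman_cov => //; exact: pS.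
split=> // xe; rewrite /filt /bayes_filt.
rewrite (@bayes_update_mixture _ _ _ (index_iota 1 (M_filt gsf s.+1).+1)
  (delta_bar gsf s.+1) (filt_mean s) (filt_cov s)).
- apply: eq_big_nat => k kM; congr (_ * _).
  by rewrite (gsf_delta_filt hgsf).
- by move=> k; rewrite mem_index_iota => /pF.
move=> u; rewrite [X in _ * X]predE /lik /obs_pdf mulr_sumr ME.
(* Likelihood times prior is a double sum over pairs (l, kappa); writing C x_t as [Cx *m u] puts
   each term in the form of the Kalman identity. *)
transitivity (\sum_(1 <= l < (M_pred gsf s.+1).+1) \sum_(1 <= kappa < K.+1)
    phi s.+1 kappa * delta_pred gsf s.+1 l *
    (gauss_pdf (zeta s.+1 kappa (y s.+1)) (Cx *m u + mu s.+1 kappa) Rv *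
     gauss_pdf u (pred_mean s l) (pred_cov s l))).
  apply: eq_bigr => l _; rewrite mulr_suml; apply: eq_bigr => kappa _.
  by rewrite mulrACA -[u in Cx *m u]vsubmxK mul_row_col mul0mx addr0.
rewrite mixture_reindex; apply: eq_big_nat => k /mixture_indexP[lM kapM kE].
rewrite (gsf_delta_bar hgsf _ kapM lM kE)// -[RHS]mulrA.
have := gauss_pdf_kalman Cx u (pred_mean s (prior_index K k))
  (zeta s.+1 (node_index K k) (y s.+1)) (mu s.+1 (node_index K k)) (pS _ lM) hRv.
move=> ->; rewrite obs_pred_cov obs_pred_mean.
by rewrite /filt_mean /= obs_pred_mean.
Qed.

(** The next extended state depends on the old one only through x_t, since d_t is drawn afresh. *)
Let Ax : 'M[R]_(n + m) := block_mx A 0 0 0.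

(** The Schur complement of [D] is [S], as G D D^-1 D G^T = G D G^T. *)
Lemma posdef_trans_cov (S : 'M[R]_n) : posdef S ->
  posdef (block_mx (S + G *m D *m G^T) (G *m D) (G *m D)^T D).
Proof.
move=> pS; apply/(posdef_schur_dr _ _ hD).
by rewrite trmx_mul (posdef_sym hD) mulmxK ?posdef_unitmx// mulmxA addrK.
Qed.

Lemma filt_pred_mixture s : filt_mixture s -> pred_mixture s.+1.
Proof.
move=> [pF filtE]; have ME := gsf_M_pred hgsf (ltn0Sn s).
(* Conjugation by [Ax] keeps only the state block of the filtered covariance, so the new cross block
   is exactly G D and the input block is [D] again. *)
have covE k : (1 <= k <= M_filt gsf s.+1)%N ->
    pred_cov s.+1 k =
    block_mx (Q + G *m D *m G^T) (G *m D) (G *m D)^T D +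
    Ax *m filt_cov s k *m Ax^T.
  move=> kM; rewrite /pred_cov (gsf_Sigma_pred hgsf)// -(filt_cov_state kM).
  rewrite -[filt_cov s k in RHS]submxK /Ax tr_block_mx !trmx0 !mulmx_block.
  by rewrite !(mul0mx, mulmx0, addr0) add_block_mx !addr0.
have meanE k : (1 <= k <= M_filt gsf s.+1)%N ->
    pred_mean s.+1 k = Ax *m filt_mean s k + col_mx (G *m dbar) dbar.
  move=> kM; rewrite /pred_mean (gsf_x_pred hgsf)// -(filt_mean_state kM).
  rewrite -[filt_mean s k in RHS]vsubmxK mul_block_col !mul0mx !addr0.
  by rewrite add_col_mx add0r.
have pW := posdef_trans_cov hQ.
split=> [k|xe]; rewrite ME.
  by move=> kM; rewrite covE//; apply: posdef_add_congr => //; exact: pF.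
rewrite /pred /= (@chapman_kolmogorov_mixture _ _ _
  (index_iota 1 (M_filt gsf s.+1).+1) (delta_filt gsf s.+1) (filt_mean s)
  (filt_cov s) Ax _ (col_mx (G *m dbar) dbar) _ _ _ pW).
- apply: eq_big_nat => k kM; rewrite (gsf_delta_pred hgsf)//.
  by rewrite covE// meanE.
- by move=> k; rewrite mem_index_iota => /pF.
- move=> z x; rewrite /trans /trans_pdf -{2}[x]vsubmxK mul_block_col !mul0mx !addr0.
  by rewrite add_col_mx add0r trmx_mul (posdef_sym hD).
- exact: filtE.
Qed.

Lemma pred_mixtureP s : pred_mixture s.
Proof.
elim: s => [|s IH]; first exact: pred_mixture0.
exact/filt_pred_mixture/pred_filt_mixture.
Qed.

Lemma marg_state_pred s x : marg_state (pred s) x =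
  \sum_(1 <= l < (M_pred gsf s.+1).+1) delta_pred gsf s.+1 l *
    gauss_pdf x (x_pred gsf s.+1 l) (Sigma_pred gsf s.+1 l).
Proof.
have [pS predE] := pred_mixtureP s.
rewrite (marg_state_mixture _ _ predE); last first.
  by move=> l; rewrite mem_index_iota => /pS.
by apply: eq_bigr => l _; rewrite col_mxKu block_mxKul.
Qed.

Lemma marg_input_pred s u : marg_input (pred s) u =
  \sum_(1 <= l < (M_pred gsf s.+1).+1) delta_pred gsf s.+1 l *
    gauss_pdf u dbar D.
Proof.
have [pS predE] := pred_mixtureP s.
rewrite (marg_input_mixture _ _ predE); last first.
  by move=> l; rewrite mem_index_iota => /pS.
by apply: eq_bigr => l _; rewrite col_mxKd block_mxKdr.
Qed.

Lemma marg_state_filt s x : marg_state (filt s.+1) x =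
  \sum_(1 <= k < (M_filt gsf s.+1).+1) delta_filt gsf s.+1 k *
    gauss_pdf x (x_filt gsf s.+1 k) (Sigma_filt gsf s.+1 k).
Proof.
have [pF filtE] := pred_filt_mixture (pred_mixtureP s).
rewrite (marg_state_mixture _ _ filtE); last first.
  by move=> k; rewrite mem_index_iota => /pF.
by apply: eq_big_nat => k kM; rewrite filt_mean_state// filt_cov_state.
Qed.

Lemma marg_input_filt s u : (0 < s)%N -> marg_input (filt s.+1) u =
  \sum_(1 <= k < (M_filt gsf s.+1).+1) delta_filt gsf s.+1 k *
    gauss_pdf u (d_filt gsf s.+1 k) (Gamma_filt gsf s.+1 k).
Proof.
move=> s0; have [pF filtE] := pred_filt_mixture (pred_mixtureP s).
rewrite (marg_input_mixture _ _ filtE); last first.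
  by move=> k; rewrite mem_index_iota => /pF.
by apply: eq_big_nat => k kM; rewrite filt_mean_input// filt_cov_input.
Qed.

End gaussian_sum_filter.

Theorem theorem1 (R : realType) (n m p : nat)
  (disp : measure_display) (Omega : measurableType disp)
  (P : probability Omega R)
  (A : 'M[R]_n) (G : 'M[R]_(n, m)) (C : 'M[R]_(p, n))
  (Q : 'M[R]_n) (Rv : 'M[R]_p) (mu1 : 'cV[R]_n) (P1 : 'M[R]_n)
  (dbar : 'cV[R]_m) (D : 'M[R]_m)
  (hQ : posdef Q) (hRv : posdef Rv) (hP1 : posdef P1) (hD : posdef D)
  (Lev : set nat) (J : nat -> set 'cV[R]_p) (eta : nat -> 'cV[R]_p)
  (q : 'cV[R]_p -> 'cV[R]_p) (hq : is_quantizer Lev J eta q)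
  (x w : nat -> Omega -> 'cV[R]_n) (dd : nat -> Omega -> 'cV[R]_m)
  (v z y : nat -> Omega -> 'cV[R]_p)
  (hsys : quantized_system P A G C q Q Rv mu1 P1 x w dd v z y)
  (hrank : \rank (C *m G) = m)
  (hdd : iid_gaussian_input P dbar D dd w)
  (omega : Omega)
  (K : nat) (phi : nat -> nat -> R)
  (zeta : nat -> nat -> 'cV[R]_p -> 'cV[R]_p) (mu : nat -> nat -> 'cV[R]_p)
  (hphi0 : forall t kappa, (1 <= t)%N -> (1 <= kappa <= K)%N ->
     0 <= phi t kappa)
  (hphi1 : forall t, (1 <= t)%N ->
     exists kappa, (1 <= kappa <= K)%N /\ 0 < phi t kappa)
  (gsf : gsf_params R n m p)
  (hgsf : gsf_recursion A G C Q Rv mu1 P1 dbar D K phi zeta mu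
          (fun t => y t omega) gsf) :
  let init := init_pdf mu1 P1 dbar D in
  let trans := trans_pdf A G Q dbar D in
  let lik := fun t (xe : 'cV[R]_(n + m)) =>
    obs_pdf C Rv K (phi t) (zeta t) (mu t) (y t omega) (usubmx xe) in
  let pred := bayes_pred init lik trans in
  let filt := bayes_filt init lik trans in
  (forall x1 : 'cV[R]_n, marg_state (pred 0%N) x1 = gauss_pdf x1 mu1 P1) /\
  (forall d0 : 'cV[R]_m, marg_input (pred 0%N) d0 = gauss_pdf d0 dbar D) /\
  (forall (t : nat) (xt : 'cV[R]_n), (1 <= t)%N ->
     marg_state (filt t) xt =
       \sum_(1 <= k < (M_filt gsf t).+1)
         delta_filt gsf t k * gauss_pdf xt (x_filt gsf t k) (Sigma_filt gsf t k)) /\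
  (forall (t : nat) (dt : 'cV[R]_m), (2 <= t)%N ->
     marg_input (filt t) dt =
       \sum_(1 <= k < (M_filt gsf t).+1)
         delta_filt gsf t k * gauss_pdf dt (d_filt gsf t k) (Gamma_filt gsf t k)) /\
  (forall (t : nat) (xt : 'cV[R]_n), (1 <= t)%N ->
     marg_state (pred t) xt =
       \sum_(1 <= k < (M_pred gsf t.+1).+1)
         delta_pred gsf t.+1 k *
           gauss_pdf xt (x_pred gsf t.+1 k) (Sigma_pred gsf t.+1 k)).
Proof.
move=> init trans lik pred filt.
split=> [x1|].
  (* At time 1 the prediction is a mixture of one component of weight 1. *)
  rewrite [LHS](marg_state_pred hQ hRv hP1 hD hgsf 0) (gsf_M_init hgsf) big_nat1.
  by rewrite (gsf_delta_init hgsf) (gsf_x_init hgsf) (gsf_Sigma_init hgsf) mul1r.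
split=> [d0|].
  rewrite [LHS](marg_input_pred hQ hRv hP1 hD hgsf 0) (gsf_M_init hgsf) big_nat1.
  by rewrite (gsf_delta_init hgsf) mul1r.
(* Time t is written s + 1; in the input claim below, t >= 2 becomes s > 0, as the identification of
   the gain requires. *)
split=> [[//|s] xt _|]; first exact: (marg_state_filt hQ hRv hP1 hD hgsf).
split=> [[//|s] dt s0|t xt _]; first exact: (marg_input_filt hQ hRv hP1 hD hgsf).
exact: (marg_state_pred hQ hRv hP1 hD hgsf).
Qed.
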